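(* Let $A=\mathbb{R}[X,Y]/(X^2+Y^2-1)$, and let $x,y\in A$ be the classes of $X$ and $Y$. Then the ideal $I=(1+x)A+yA$ of $A$ is not principal. *)

(* Defs.v *)
From HB Require Import structures.
From mathcomp Require Import all_boot all_order all_algebra.
From mathcomp Require Import boolp classical_sets reals.
From mathcomp Require Import mpoly.

Set Implicit Arguments.
Unset Strict Implicit.
Unset Printing Implicit Defensive.

Import GRing.Theory.
Local Open Scope classical_set_scope.
Local Open Scope ring_scope.

Section Ideals.
Variable A : comNzRingType.

Definition ideal1 (a : A) : set A := [set z | exists u : A, z = a * u].

Definition ideal2 (a b : A) : set A :=
  [set z | exists u v : A, z = a * u + b * v].

Definition principal (I : set A) : Prop := exists c : A, I = ideal1 c.

End Ideals.

Section Circle.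
Variable R : realType.

Definition polyX : {mpoly R[2]} := 'X_(ord0 : 'I_2).
Definition polyY : {mpoly R[2]} := 'X_(ord_max : 'I_2).

Definition circle_poly : {mpoly R[2]} := polyX ^+ 2 + polyY ^+ 2 - 1.

(* The library quotient takes a boolean predicate, whence the [asbool]. *)
Definition circle_ideal : {mpoly R[2]} -> bool :=
  fun p => `[< ideal1 circle_poly p >].

(* [idealr] includes properness, shown here by evaluating at (1, 0). *)
Fact circle_ideal_closed : idealr_closed (circle_ideal : {pred {mpoly R[2]}}).
Proof.
split.
- by apply/asboolP; exists 0; rewrite mulr0.
- apply/negP => /asboolP [u].
  move/(congr1 (meval (fun i : 'I_2 => if i == ord0 then 1 else 0))).
  rewrite meval1 mevalM mevalB mevalD !rmorphXn /= !mevalXU meval1 /=.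
  by rewrite expr1n expr0n /= addr0 subrr mul0r => /eqP; rewrite oner_eq0.
- move=> a p q /asboolP [u ->] /asboolP [v ->]; apply/asboolP.
  by exists (a * u + v); rewrite mulrDr mulrCA.
Qed.

HB.instance Definition _ :=
  isIdealr.Build {mpoly R[2]} circle_ideal circle_ideal_closed.

Definition circle_idealr : idealr {mpoly R[2]} := circle_ideal.

Definition circle_ring : comNzRingType := {ideal_quot circle_idealr}.

Definition circle_x : circle_ring := (\pi_({ideal_quot circle_idealr}) polyX)%qT.
Definition circle_y : circle_ring := (\pi_({ideal_quot circle_idealr}) polyY)%qT.

End Circle.

(* Main.v *)
Require Import Defs.
From mathcomp Require Import all_boot all_order all_algebra.
From mathcomp Require Import boolp classical_sets reals mpoly.
From mathcomp Require Import ring lra.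

(** The algebra [A] is free over [R[X]] with basis [1, y], and [p + q y] has
    norm [p^2 - q^2 (1 - X^2)], a polynomial which is nonnegative outside
    [(-1, 1)].  If [c] generated [I], its norm would divide the norms [(1 + X)^2]
    and [X^2 - 1] of the generators, hence also [2 (1 + X)]; it vanishes at
    [-1] because the whole ideal vanishes at [(-1, 0)].  So it would be a nonzero
    multiple of [1 + X], which has opposite signs at [2] and [-2]. *)

Set Implicit Arguments.
Unset Strict Implicit.
Unset Printing Implicit Defensive.

Import Order.TTheory GRing.Theory Num.Theory.
Local Open Scope ring_scope.

Section Evaluation.
Variable R : realType.
Implicit Types (f g : {mpoly R[2]}) (a b : circle_ring R) (s t : R).

Definition plane_point s t (i : 'I_2) : R := if i == ord0 then s else t.

(** The value is taken on a chosen representative, so it is intrinsic, and multiplicative in [a],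
    only at points of the circle, where [circle_poly] vanishes. *)
Definition circle_eval s t a : R := (repr a).@[plane_point s t].

Section OnCircle.
Variables (s t : R) (st1 : s ^+ 2 + t ^+ 2 = 1).

Lemma circle_eval_pi f :
  circle_eval s t (\pi_({ideal_quot (circle_idealr R)}) f)%qT =
  f.@[plane_point s t].
Proof.
apply/eqP; rewrite -subr_eq0 -mevalB.
set g := repr _.
have: (g - f) \in circle_idealr R by rewrite Quotient.idealrBE reprK.
move=> /asboolP[u ->].
by rewrite mevalM mevalB mevalD !rmorphXn /= !mevalXU meval1 /plane_point /=
  st1 subrr mul0r.
Qed.

Lemma circle_evalD a b :
  circle_eval s t (a + b) = circle_eval s t a + circle_eval s t b.
Proof.
rewrite -[a]reprK -[b]reprK -(rmorphD \pi_({ideal_quot (circle_idealr R)})%qT).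
by rewrite !circle_eval_pi mevalD.
Qed.

Lemma circle_evalM a b :
  circle_eval s t (a * b) = circle_eval s t a * circle_eval s t b.
Proof.
rewrite -[a]reprK -[b]reprK -(rmorphM \pi_({ideal_quot (circle_idealr R)})%qT).
by rewrite !circle_eval_pi mevalM.
Qed.

Lemma circle_eval1 : circle_eval s t 1 = 1.
Proof.
rewrite -(rmorph1 \pi_({ideal_quot (circle_idealr R)})%qT).
by rewrite circle_eval_pi meval1.
Qed.

Lemma circle_eval_x : circle_eval s t (circle_x R) = s.
Proof. by rewrite circle_eval_pi mevalXU. Qed.

Lemma circle_eval_y : circle_eval s t (circle_y R) = t.
Proof. by rewrite circle_eval_pi mevalXU. Qed.

End OnCircle.

(** The decomposition [p + q y] is recorded through values on the circle, with [p] and [q] the same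
    for all points. *)
Definition linear_in_y f :=
  exists p q : {poly R}, forall s t, s ^+ 2 + t ^+ 2 = 1 ->
    f.@[plane_point s t] = p.[s] + q.[s] * t.

Lemma linear_in_yD f g :
  linear_in_y f -> linear_in_y g -> linear_in_y (f + g).
Proof.
move=> [p [q fE]] [p' [q' gE]]; exists (p + p'), (q + q') => s t st1.
by rewrite mevalD fE // gE // !hornerD; ring.
Qed.

Lemma linear_in_yM f g :
  linear_in_y f -> linear_in_y g -> linear_in_y (f * g).
Proof.
move=> [p [q fE]] [p' [q' gE]].
(* The [y ^ 2] term of the product is folded back by [y ^ 2 = 1 - X ^ 2]. *)
exists (p * p' + q * q' * (1 - 'X^2)), (p * q' + q * p') => s t st1.
rewrite mevalM fE // gE // !hornerE.
have -> : 1 - s ^+ 2 = t ^+ 2 by rewrite -st1 addrAC subrr add0r.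
ring.
Qed.

Lemma linear_in_yC (c : R) : linear_in_y c%:MP.
Proof. by exists c%:P, 0 => s t _; rewrite mevalC !hornerE. Qed.

Lemma linear_in_yX (i : 'I_2) : linear_in_y 'X_i.
Proof.
case: (eqVneq i ord0) => [->|i0].
  by exists 'X, 0 => s t _; rewrite mevalXU !hornerE.
by exists 0, 1 => s t _; rewrite mevalXU /plane_point (negPf i0) !hornerE.
Qed.

Lemma mpoly_linear_in_y f : linear_in_y f.
Proof.
elim/mpolyind: f => [|c m p _ _ IHp].
  by rewrite -mpolyC0; apply: linear_in_yC.
apply: linear_in_yD => //; rewrite -mul_mpolyC.
apply: linear_in_yM; first exact: linear_in_yC.
rewrite mpolyXE_id; elim/big_ind: _ => [||i _].
- by rewrite -mpolyC1; apply: linear_in_yC.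
- exact: linear_in_yM.
elim: (m i) => [|k IHk]; first by rewrite expr0 -mpolyC1; apply: linear_in_yC.
by rewrite exprS; apply: linear_in_yM => //; apply: linear_in_yX.
Qed.

(** On the circle the norm is the product of the values at the conjugate points [(s, t)] and
    [(s, - t)]. As a polynomial in [s] it also makes sense for [s ^ 2 > 1], where no real point lies
    above [s]; its sign is read off there. *)
Lemma circle_norm a : exists N : {poly R},
  (forall s t, s ^+ 2 + t ^+ 2 = 1 ->
     N.[s] = circle_eval s t a * circle_eval s (- t) a)
  /\ (forall s, 1 <= s ^+ 2 -> 0 <= N.[s]).
Proof.
have [p [q aE]] := mpoly_linear_in_y (repr a).
exists (p ^+ 2 - q ^+ 2 * (1 - 'X^2)); split=> [s t st1|s s1]; rewrite !hornerE.
  rewrite /circle_eval !aE ?sqrrN //.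
  have -> : 1 - s ^+ 2 = t ^+ 2 by rewrite -st1 addrAC subrr add0r.
  ring.
have := mulr_ge0 (sqr_ge0 q.[s]) (_ : 0 <= s ^+ 2 - 1).
rewrite subr_ge0 => /(_ s1); have := sqr_ge0 p.[s]; lra.
Qed.

End Evaluation.

(** Norm identities are only known where the circle has real points. The numbers [1 / (i + 1)]
    supply as many distinct roots of [p - q] in the interval as its size. *)
Lemma poly_eq_on_unit_interval (R : realType) (p q : {poly R}) :
  (forall s, 0 <= s <= 1 -> p.[s] = q.[s]) -> p = q.
Proof.
move=> pq; apply/eqP; rewrite -subr_eq0; apply/eqP.
apply: (@roots_geq_poly_eq0 _ _
  [seq (i.+1%:R : R)^-1 | i <- iota 0 (size (p - q))]).
- apply/allP => _ /mapP[i _ ->]; rewrite rootE hornerD hornerN pq ?subrr //.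
  by rewrite invr_ge0 ler0n invf_le1 ?ltr0n // ler1n.
- rewrite map_inj_uniq ?iota_uniq // => i j /invr_inj/eqP.
  by rewrite eqr_nat => /eqP[].
- by rewrite size_map size_iota.
Qed.

Theorem mainTheorem2 (R : realType) :
  ~ principal (ideal2 (1 + circle_x R) (circle_y R)).
Proof.
move=> [c Ic].
have [u cu] : ideal1 c (1 + circle_x R).
  by rewrite -Ic; exists 1, 0; rewrite mulr1 mulr0 addr0.
have [v cv] : ideal1 c (circle_y R).
  by rewrite -Ic; exists 0, 1; rewrite mulr1 mulr0 add0r.
have [a [b cab]] : ideal2 (1 + circle_x R) (circle_y R) c.
  by rewrite Ic; exists 1; rewrite mulr1.
have [N [NE N_ge0]] := circle_norm c.
have [Nu [NuE _]] := circle_norm u.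
have [Nv [NvE _]] := circle_norm v.
(* Here [N * Nu] is [(1 + X) ^ 2] and [N * Nv] is [t * (- t) = X ^ 2 - 1]; their difference is
   [2 (1 + X)]. *)
have NuvE : (1 + 'X) * 2%:P = N * (Nu - Nv).
  apply: poly_eq_on_unit_interval => s /andP[s0 s1].
  pose t := Num.sqrt (1 - s ^+ 2).
  have t2 : t ^+ 2 = 1 - s ^+ 2 by rewrite sqr_sqrtr // subr_ge0 expr_le1.
  have st : s ^+ 2 + t ^+ 2 = 1 by rewrite t2 addrC subrK.
  have st' : s ^+ 2 + (- t) ^+ 2 = 1 by rewrite sqrrN.
  have evu r (sr : s ^+ 2 + r ^+ 2 = 1) :
      circle_eval s r c * circle_eval s r u = 1 + s.
    by rewrite -circle_evalM // -cu circle_evalD // circle_eval1 // circle_eval_x.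
  have evv r (sr : s ^+ 2 + r ^+ 2 = 1) :
      circle_eval s r c * circle_eval s r v = r.
    by rewrite -circle_evalM // -cv circle_eval_y.
  rewrite !hornerE (NE s t) // (NuE s t) // (NvE s t) //.
  rewrite mulrBr mulrACA !evu // mulrACA !evv //.
  rewrite mulrN -(expr2 t) t2; ring.
(* The point [(-1, 0)] is its own conjugate, and both generators vanish there, hence so does [c]. *)
have N1 : root N (-1).
  have on : (-1) ^+ 2 + 0 ^+ 2 = 1 :> R by rewrite sqrrN expr1n expr0n addr0.
  rewrite rootE (NE _ 0) // oppr0 cab circle_evalD // !circle_evalM //.
  rewrite circle_evalD // circle_eval1 // circle_eval_x // circle_eval_y //.
  by rewrite subrr !mul0r addr0 mulr0.
have [M NM] := factor_theorem _ _ N1.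
have XD1 : 'X - (-1)%:P = 1 + 'X :> {poly R} by rewrite polyCN opprK addrC.
rewrite XD1 mulrC in NM.
have X1_neq0 : 1 + 'X != 0 :> {poly R} by rewrite -XD1 polyXsubC_eq0.
(* Cancelling [1 + X] makes [M] a divisor of a nonzero constant, hence a constant [k]. *)
have M2 : M * (Nu - Nv) = 2%:P.
  by apply: (mulfI X1_neq0); rewrite mulrA -NM NuvE.
have M_unit : size M == 1.
  have two_neq0 : (2 : R) != 0 by rewrite pnatr_eq0.
  have := size_polyC (2 : R); rewrite two_neq0 -M2 => /eqP.
  by rewrite size_mul_eq1 => /andP[].
have /size_poly1P[k k_neq0 Mk] := M_unit.
(* With [N = (1 + X) k], these two values are [3 k] and [- k], which forces [k = 0]. *)
have Npos : 0 <= N.[2] by apply: N_ge0; lra.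
have Nneg : 0 <= N.[-2] by apply: N_ge0; lra.
move: Npos Nneg k_neq0; rewrite NM Mk !(hornerM, hornerD, hornerC, hornerX)
  => Npos Nneg /eqP[].
lra.
Qed.
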